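(* Adopt the setting of the context. Let $Q_L\Subset Q_{L'}^h$ (i.e. $Q_L$ is contained in the interior of $Q_{L'}^h$) and $\lambda h\le2dN$. Let $\pi_n:\mathbb R^d\to A$ be a Borel policy, $w_n=S_{\varepsilon,h}(\pi_n)$, let $v_{\theta_n}:\mathbb R^d\to\mathbb R$ be a bounded Borel function, and put $\xi_n^{\rm val}=\|v_{\theta_n}-w_n\|_{\infty,Q_L}$. With $d_{L,L'}=\mathrm{dist}(Q_L,\partial_hQ_{L'})$ one has $$\xi_n^{\rm val}\le\lambda^{-1}\,\|\mathcal L^{\pi_n}_{\varepsilon,h}v_{\theta_n}\|_{\infty,Q_{L'}^h}+e^{-\lambda d_{L,L'}/(4dN)}\bigl(\|v_{\theta_n}\|_{\infty,\partial_hQ_{L'}}+M_\varepsilon\bigr),\qquad M_\varepsilon=\frac{\|f\|_\infty+M_p/\varepsilon}{\lambda}.$$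
   Context: Setting. $|\cdot|$ is the Euclidean norm; $\|z\|_{\infty,D}=\sup_D|z|$ is the pointwise supremum, $\|\cdot\|_\infty$ the supremum over the full domain. $\Omega\subset\mathbb R^d$ is a bounded domain with $C^2$ boundary and outward unit normal $n$; $A\subset\mathbb R^m$ is compact; $\lambda>0$; $b:\mathbb R^d\times A\to\mathbb R^d$ and $f:\mathbb R^d\times A\to[0,\infty)$ are continuous, bounded, and Lipschitz in $x$ uniformly in $a$, with $\mathrm{Lip}_x(b)<\lambda$. There is $\nu>0$ such that for each $x\in\partial\Omega$ some $a\in A$ satisfies $b(x,a)\cdot n(x)\le-\nu$. The Hamiltonian $H(x,p)=\sup_{a\in A}\{-b(x,a)\cdot p-f(x,a)\}$ tends to $\infty$ as $|p|\to\infty$ uniformly in $x\in\overline\Omega$. For a fixed $M_p>0$, $p_\Omega(x)=\min\{\mathrm{dist}(x,\overline\Omega),M_p\}$. $N>0$ is fixed with $N\ge\frac12\sup_{x,a}\max_i|b_i(x,a)|$; $h,\varepsilon>0$. Scheme. $(\nabla_hv)_i(x)=\frac{v(x+he_i)-v(x-he_i)}{2h}$, $\Delta_hv(x)=\sum_{i=1}^d\frac{v(x+he_i)-2v(x)+v(x-he_i)}{h^2}$, $\nu_h=Nh$. A policy is a Borel map $\pi:\mathbb R^d\to A$; $c_\pi=f(\cdot,\pi)+p_\Omega/\varepsilon$; $\mathcal L^\pi_{\varepsilon,h}v=\lambda v-b(\cdot,\pi)\cdot\nabla_hv-\nu_h\Delta_hv-c_\pi$. $S_{\varepsilon,h}(\pi)$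 is the unique bounded Borel function on $\mathbb R^d$ with $\mathcal L^\pi_{\varepsilon,h}S_{\varepsilon,h}(\pi)=0$ pointwise. Boxes. For $0<h<L$: $Q_L=[-L,L]^d$ (containing $\overline\Omega$ in its interior), $Q_L^h=[-L+h,L-h]^d$, $\partial_hQ_L=Q_L\setminus Q_L^h$; similarly for $L'$. *)

(* Defs.v *)
From HB Require Import structures.
From mathcomp Require Import all_boot all_order all_algebra.
From mathcomp Require Import all_classical all_reals all_analysis.

Set Implicit Arguments.
Unset Strict Implicit.
Unset Printing Implicit Defensive.

Import Order.TTheory GRing.Theory Num.Theory.
Import numFieldNormedType.Exports.

Local Open Scope classical_set_scope.
Local Open Scope ring_scope.

(* The library norm `|x| on 'rV[R]_d is the max norm. It induces the same
   topology, Borel sets and bounded sets as the Euclidean norm, so it is used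
   for those notions only; every quantitative statement uses enorm. *)
Section Euclidean.
Context {R : realType} {d : nat}.
Implicit Types (x y : 'rV[R]_d) (S T : set 'rV[R]_d).

Definition dot x y : R := \sum_i x 0 i * y 0 i.

Definition enorm x : R := Num.sqrt (dot x x).

Definition basis_vec (i : 'I_d) : 'rV[R]_d := delta_mx 0 i.

Definition dist_to_set x S : R := inf [set enorm (x - y) | y in S].

Definition dist_sets S T : R := inf [set enorm (x - y) | x in S & y in T].

End Euclidean.

(* sup_D |z|. As a real supremum it is meaningful only when D is nonempty and
   z is bounded on D. *)
Definition sup_norm {R : realType} {T : Type} (D : set T) (z : T -> R) : R :=
  sup [set `|z x| | x in D].

Definition borel_fun {T U : ptopologicalType} (g : T -> U) : Prop :=
  measurable_fun setT
    (g : g_sigma_algebraType (@open T) -> g_sigma_algebraType (@open U)).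

Section Domain.
Context {R : realType} {d : nat}.
Implicit Types (Omega U : set 'rV[R]_d) (rho : 'rV[R]_d -> R) (x v : 'rV[R]_d).

Fixpoint Ck_on (k : nat) U rho : Prop :=
  (forall x, U x -> {for x, continuous rho}) /\
  if k is k'.+1 then
    forall i : 'I_d,
      (forall x, U x -> derivable rho x (basis_vec i)) /\
      Ck_on k' U (fun x => 'D_(basis_vec i) rho x)
  else True.

Definition grad rho x : 'rV[R]_d := \row_i 'D_(basis_vec i) rho x.

Definition boundary Omega : set 'rV[R]_d := closure Omega `\` Omega°.

Definition is_domain Omega : Prop :=
  [/\ open Omega, connected Omega & Omega !=set0].

(* Omega lies locally on one side of a regular C^2 level set:
   Omega = {rho < 0} in U, with nonvanishing gradient. *)
Definition C2_defining_function Omega x U rho : Prop :=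
  [/\ open U, U x, Ck_on 2 U rho, (forall y, U y -> grad rho y != 0) &
      Omega `&` U = [set y | U y /\ rho y < 0]].

Definition C2_boundary Omega : Prop :=
  forall x, boundary Omega x ->
    exists U rho, C2_defining_function Omega x U rho.

(* The vector v does not depend on the choice of U and rho. *)
Definition outward_unit_normal Omega x v : Prop :=
  exists U rho, C2_defining_function Omega x U rho /\
    v = (enorm (grad rho x))^-1 *: grad rho x.

End Domain.

Section Control.
Context {R : realType} {d m : nat}.
Implicit Types (Omega : set 'rV[R]_d) (A : set 'rV[R]_m).
Implicit Types (b : 'rV[R]_d -> 'rV[R]_m -> 'rV[R]_d).
Implicit Types (f : 'rV[R]_d -> 'rV[R]_m -> R).

(* Coefficients are total functions of (x, a); only their values at a in A are
   ever constrained or used. *)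

Definition continuous_coef {V : topologicalType} A
    (g : 'rV[R]_d -> 'rV[R]_m -> V) : Prop :=
  {within setT `*` A, continuous (fun z : 'rV[R]_d * 'rV[R]_m => g z.1 z.2)}.

Definition bounded_coef {V : normedModType R} A
    (g : 'rV[R]_d -> 'rV[R]_m -> V) : Prop :=
  [bounded g z.1 z.2 | z in setT `*` A].

Definition lipschitz_coef {V : zmodType} (nrm : V -> R) A
    (g : 'rV[R]_d -> 'rV[R]_m -> V) : Prop :=
  exists K : R, forall a, A a -> forall x y,
    nrm (g x a - g y a) <= K * enorm (x - y).

Definition Lipx {V : zmodType} (nrm : V -> R) A
    (g : 'rV[R]_d -> 'rV[R]_m -> V) : R :=
  sup [set r | exists a x y, [/\ A a, x <> y &
    r = nrm (g x a - g y a) / enorm (x - y)]].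

Definition hamiltonian A b f (x p : 'rV[R]_d) : R :=
  sup [set - dot (b x a) p - f x a | a in A].

Definition uniformly_coercive Omega (H : 'rV[R]_d -> 'rV[R]_d -> R) : Prop :=
  forall C : R, exists r : R, forall x p,
    closure Omega x -> r < enorm p -> C < H x p.

(* sup_{x,a} max_i |b_i(x,a)| *)
Definition max_drift A b : R :=
  sup [set \big[Num.max/0]_(i < d) `|b z.1 z.2 0 i| | z in setT `*` A].

Definition penalty Omega (Mp : R) (x : 'rV[R]_d) : R :=
  Num.min (dist_to_set x (closure Omega)) Mp.

Definition disc_grad (h : R) (v : 'rV[R]_d -> R) (x : 'rV[R]_d) : 'rV[R]_d :=
  \row_i ((v (x + h *: basis_vec i) - v (x - h *: basis_vec i)) / (2 * h)).

Definition disc_lap (h : R) (v : 'rV[R]_d -> R) (x : 'rV[R]_d) : R :=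
  \sum_(i < d) (v (x + h *: basis_vec i) - 2 * v x + v (x - h *: basis_vec i))
    / h ^+ 2.

Definition is_policy A (pol : 'rV[R]_d -> 'rV[R]_m) : Prop :=
  borel_fun pol /\ forall x, A (pol x).

Definition running_cost Omega f (Mp eps : R) (pol : 'rV[R]_d -> 'rV[R]_m)
    (x : 'rV[R]_d) : R :=
  f x (pol x) + penalty Omega Mp x / eps.

Definition policy_op Omega b f (lambda Mp N eps h : R)
    (pol : 'rV[R]_d -> 'rV[R]_m) (v : 'rV[R]_d -> R) (x : 'rV[R]_d) : R :=
  lambda * v x - dot (b x (pol x)) (disc_grad h v x)
  - (N * h) * disc_lap h v x - running_cost Omega f Mp eps pol x.

Definition bounded_borel (v : 'rV[R]_d -> R) : Prop :=
  borel_fun v /\ bounded_fun v.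

(* The relation w = S_{eps,h}(pol). *)
Definition is_policy_value Omega b f (lambda Mp N eps h : R)
    (pol : 'rV[R]_d -> 'rV[R]_m) (w : 'rV[R]_d -> R) : Prop :=
  bounded_borel w /\
  forall x, policy_op Omega b f lambda Mp N eps h pol w x = 0.

End Control.

Section Boxes.
Context {R : realType} {d : nat}.

Definition box (L : R) : set 'rV[R]_d :=
  [set x | forall i, - L <= x 0 i <= L].

Definition inner_box (L h : R) : set 'rV[R]_d :=
  [set x | forall i, - L + h <= x 0 i <= L - h].

Definition box_layer (L h : R) : set 'rV[R]_d := box L `\` inner_box L h.

End Boxes.

(* Main.v *)
Require Import Defs.
From HB Require Import structures.
From mathcomp Require Import all_boot all_order all_algebra.
From mathcomp Require Import all_classical all_reals all_analysis.
From mathcomp Require Import ring lra.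

Set Implicit Arguments.
Unset Strict Implicit.
Unset Printing Implicit Defensive.

Import Order.TTheory GRing.Theory Num.Theory.
Import numFieldNormedType.Exports.

Local Open Scope classical_set_scope.
Local Open Scope ring_scope.

(* Set c = 2dN/h.  Multiplied out, the scheme reads
     (lambda + c) v(x) - (a combination of the 2d neighbour values) = source,
   and N >= |b_i|/2 makes the neighbour weights nonnegative with sum c.  So if
   |source| <= rho, a bound rho/lambda + B on the neighbours improves to
   rho/lambda + kappa B at x, where kappa = c/(lambda + c) = 1/(1 + s) and
   s = lambda h/(2dN).  Applied on the whole space this gives |w| <= M_eps.
   Applied to e = v - w on the box of half-width L', it first gives the maximum
   principle |e| <= rho/lambda + G, with G a bound on the layer, and then one
   factor kappa on G for each retreat of the box by h.  From L' to L there are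
   at least d_LL'/h retreats, and 1 + s >= exp(s/2) for 0 <= s <= 1. *)

(** * Supremum norms and a contraction principle *)

Lemma bounded_on_exists (R : realType) (T : Type) (V : normedModType R)
    (D : set T) (z : T -> V) :
  [bounded z x | x in D] -> exists M : R, forall x, D x -> `|z x| <= M.
Proof.
move=> zb; have [M _ zM] := ex_strict_bound_gt0 zb.
by exists M => x Dx; apply/ltW/zM.
Qed.

Section SupNorm.
Context {R : realType} {T : Type}.
Implicit Types (D : set T) (z : T -> R) (M : R).

Lemma sup_norm_ge D z M x :
  (forall y, D y -> `|z y| <= M) -> D x -> `|z x| <= sup_norm D z.
Proof.
move=> zM Dx; apply: ub_le_sup; last by exists x.
by exists M => _ [y Dy <-]; exact: zM.
Qed.

Lemma sup_norm_le D z M :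
  D !=set0 -> (forall y, D y -> `|z y| <= M) -> sup_norm D z <= M.
Proof.
move=> [x Dx] zM; apply: ge_sup; first by exists `|z x|, x.
by move=> _ [y Dy <-]; exact: zM.
Qed.

(* If the excess of |z| over a were positive, its supremum K would satisfy
   K <= kappa K < K. *)
Lemma contraction_bound D z M a kappa :
  kappa < 1 -> (forall x, D x -> `|z x| <= M) ->
  (forall K, 0 <= K -> (forall x, D x -> `|z x| <= a + K) ->
     forall x, D x -> `|z x| <= a + kappa * K) ->
  forall x, D x -> `|z x| <= a.
Proof.
move=> kappa1 zM step x Dx; rewrite leNgt; apply/negP => zxa.
have zsup y : D y -> `|z y| <= sup_norm D z by exact: sup_norm_ge zM.
pose K := sup_norm D z - a.
have K0 : 0 < K by rewrite subr_gt0; apply: lt_le_trans (zsup x Dx).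
have : sup_norm D z <= a + kappa * K.
  apply: sup_norm_le; first by exists x.
  by apply: step (ltW K0) _ => y Dy; rewrite subrKC; exact: zsup.
have : kappa * K < K by rewrite gtr_pMl.
rewrite /K; lra.
Qed.

End SupNorm.

(** * The scheme as a weighted combination of neighbour values *)

Section DiscreteOperator.
Context {R : realType} {d : nat}.
Implicit Types (lambda N h rho B : R) (q x : 'rV[R]_d) (v w : 'rV[R]_d -> R).

(** The linear part of [policy_op], with the drift at [x] frozen to a vector [q]. Without the cost
    it acts linearly on differences [v - w]. *)
Definition discrete_op lambda N h q v x : R :=
  lambda * v x - dot q (disc_grad h v x) - (N * h) * disc_lap h v x.

Lemma discrete_opE lambda N h q v x : h != 0 ->
  discrete_op lambda N h q v x =
  (lambda + 2 * d%:R * N / h) * v x -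
  \sum_i ((N / h + q 0 i / (2 * h)) * v (x + h *: basis_vec i) +
          (N / h - q 0 i / (2 * h)) * v (x - h *: basis_vec i)).
Proof.
move=> h0; have h20 : 2 * h != 0 by rewrite mulf_neq0 ?pnatr_eq0.
have -> : (lambda + 2 * d%:R * N / h) * v x =
    lambda * v x + \sum_(i < d) (2 * N / h * v x).
  rewrite sumr_const card_ord -[in RHS]mulr_natl; ring.
rewrite /discrete_op /dot /disc_lap mulr_sumr -!addrA; congr (_ + _).
rewrite -!sumrN -!big_split /=; apply: eq_bigr => i _.
by rewrite mxE; field.
Qed.

Lemma discrete_opB lambda N h q v w x :
  discrete_op lambda N h q (fun y => v y - w y) x =
  discrete_op lambda N h q v x - discrete_op lambda N h q w x.
Proof.
rewrite /discrete_op.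
have -> : dot q (disc_grad h (fun y => v y - w y) x) =
    dot q (disc_grad h v x) - dot q (disc_grad h w x).
  by rewrite /dot -sumrB; apply: eq_bigr => i _; rewrite !mxE; ring.
have -> : disc_lap h (fun y => v y - w y) x = disc_lap h v x - disc_lap h w x.
  by rewrite /disc_lap -sumrB; apply: eq_bigr => i _; ring.
ring.
Qed.

(* The condition |q_i| <= 2N makes all neighbour weights nonnegative, with sum
   [2 d N / h]. *)
Lemma sum_weights_le N h q v x B : 0 < h ->
  (forall i, `|q 0 i| <= 2 * N) ->
  (forall i, `|v (x + h *: basis_vec i)| <= B) ->
  (forall i, `|v (x - h *: basis_vec i)| <= B) ->
  `|\sum_i ((N / h + q 0 i / (2 * h)) * v (x + h *: basis_vec i) +
            (N / h - q 0 i / (2 * h)) * v (x - h *: basis_vec i))| <=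
  2 * d%:R * N / h * B.
Proof.
move=> h0 qN vp vm.
have -> : 2 * d%:R * N / h * B = \sum_(i < d) (2 * N / h * B).
  rewrite sumr_const card_ord -[in RHS]mulr_natl; ring.
apply: le_trans (ler_norm_sum _ _ _) _; apply: ler_sum => i _.
have /ler_normlP[q1 q2] := qN i.
have wp : 0 <= N / h + q 0 i / (2 * h).
  have -> : N / h + q 0 i / (2 * h) = (2 * N + q 0 i) / (2 * h).
    by field; rewrite gt_eqF.
  by rewrite divr_ge0 ?mulr_ge0 ?(ltW h0)//; lra.
have wm : 0 <= N / h - q 0 i / (2 * h).
  have -> : N / h - q 0 i / (2 * h) = (2 * N - q 0 i) / (2 * h).
    by field; rewrite gt_eqF.
  by rewrite divr_ge0 ?mulr_ge0 ?(ltW h0)//; lra.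
apply: le_trans (ler_normD _ _) _.
rewrite !normrM !(ger0_norm wp) !(ger0_norm wm).
have := ler_wpM2l wp (vp i); have := ler_wpM2l wm (vm i).
have -> : 2 * N / h * B = (N / h + q 0 i / (2 * h)) * B
    + (N / h - q 0 i / (2 * h)) * B by ring.
lra.
Qed.

(** With c = 2dN/h, the diagonal contributes lambda + c and the neighbours c. This crude bound
    serves to make the supremum of a residual a genuine one. *)
Lemma discrete_op_le lambda N h q v x B : 0 < lambda -> 0 < N -> 0 < h ->
  (forall i, `|q 0 i| <= 2 * N) -> (forall y, `|v y| <= B) ->
  `|discrete_op lambda N h q v x| <= (lambda + 4 * d%:R * N / h) * B.
Proof.
move=> l0 N0 h0 qN vB; rewrite discrete_opE ?gt_eqF//.
apply: le_trans (ler_normB _ _) _.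
have c0 : 0 <= 2 * d%:R * N / h.
  by rewrite divr_ge0 ?(ltW h0)// !mulr_ge0 ?ler0n ?(ltW N0).
have := sum_weights_le h0 qN (fun i => vB (x + h *: basis_vec i))
  (fun i => vB (x - h *: basis_vec i)).
rewrite normrM (ger0_norm (addr_ge0 (ltW l0) c0)).
have := ler_wpM2l (addr_ge0 (ltW l0) c0) (vB x).
have -> : (lambda + 4 * d%:R * N / h) * B =
  (lambda + 2 * d%:R * N / h) * B + 2 * d%:R * N / h * B by ring.
lra.
Qed.

(** Isolating the diagonal term gives (lambda + c)|v x| <= rho + c(rho/lambda + B). Since rho + c
    rho/lambda = (lambda + c) rho/lambda, the level rho/lambda is reproduced exactly and only [B] is
    contracted. *)
Lemma one_step_bound lambda N h q v x rho B : (0 < d)%N -> 0 < lambda -> 0 < N -> 0 < h ->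
  (forall i, `|q 0 i| <= 2 * N) ->
  `|discrete_op lambda N h q v x| <= rho ->
  (forall i, `|v (x + h *: basis_vec i)| <= rho / lambda + B) ->
  (forall i, `|v (x - h *: basis_vec i)| <= rho / lambda + B) ->
  `|v x| <= rho / lambda + (1 + lambda * h / (2 * d%:R * N))^-1 * B.
Proof.
move=> hd l0 N0 h0 qN + vp vm; rewrite discrete_opE ?gt_eqF//.
have d0 : 0 < d%:R :> R by rewrite ltr0n.
have := sum_weights_le h0 qN vp vm.
set S := (X in `|X| <= _); set c := _ / h => Sle ople.
have c0 : 0 < c by rewrite divr_gt0// !mulr_gt0.
have lc0 : 0 < lambda + c by rewrite addr_gt0.
have : (lambda + c) * `|v x| <= rho + c * (rho / lambda + B).
  rewrite -{1}(gtr0_norm lc0) -normrM -[_ * v x](subrK S).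
  by apply: le_trans (ler_normD _ _) _; rewrite lerD.
rewrite -ler_pdivlMl// => /le_trans; apply.
rewrite le_eqVlt; apply/orP; left; apply/eqP.
have sc : 1 + lambda * h / (2 * d%:R * N) = (lambda + c) / c.
  rewrite /c; field.
  by rewrite !gt_eqF.
by rewrite sc; field; rewrite !gt_eqF.
Qed.

End DiscreteOperator.

(** From exp(-s/2) >= 1 - s/2 and (1 + s)(1 - s/2) = 1 + s(1 - s)/2, which is at least 1 on
    [0,1]. *)
Lemma inv1D_exp_le (R : realType) (s : R) (k : nat) : 0 <= s <= 1 ->
  (1 + s)^-1 ^+ k <= expR (- (k%:R * (s / 2))).
Proof.
move=> /andP[s0 s1]; rewrite expRN expRM_natl exprVn.
have e0 := expR_gt0 (s / 2).
have s1_gt0 : 0 < 1 + s by lra.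
rewrite lef_pV2 ?posrE ?exprn_gt0//.
apply: lerXn2r; rewrite ?nnegrE ?(ltW e0) ?(ltW s1_gt0)//.
have : 1 - s / 2 <= (expR (s / 2))^-1 by rewrite -expRN; exact: expR_ge1Dx.
rewrite -(ler_pM2r e0) mulVf ?gt_eqF// => h1.
have := ler_wpM2l (ltW s1_gt0) h1.
have : 0 <= s * (1 - s) / 2 * expR (s / 2).
  by rewrite mulr_ge0 ?(ltW e0)// divr_ge0// mulr_ge0// subr_ge0.
lra.
Qed.

(** * Geometry of boxes and layers, and decay from box to box *)

Section Boxes.
Context {R : realType} {d : nat}.
Implicit Types (x : 'rV[R]_d) (L : R).

Lemma basis_vecE i j : (basis_vec i : 'rV[R]_d) 0 j = (j == i)%:R.
Proof. by rewrite mxE eqxx. Qed.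

Lemma box_neighbour L h x i : 0 < h -> box (L - h) x ->
  box L (x + h *: basis_vec i) /\ box L (x - h *: basis_vec i).
Proof.
move=> h0 bx; split=> j; have /andP[] := bx j; rewrite !(mxE, basis_vecE) => ? ?;
  by apply/andP; split; case: (j == i); rewrite /= ?mulr1 ?mulr0; lra.
Qed.

Lemma inner_boxE L h : inner_box L h = box (L - h) :> set 'rV[R]_d.
Proof. by apply/seteqP; split=> x bx i; have := bx i; rewrite opprB addrC. Qed.

Lemma le_box L1 L2 : L1 <= L2 -> box L1 `<=` (box L2 : set 'rV[R]_d).
Proof. by move=> L12 x bx i; have /andP[? ?] := bx i; apply/andP; split; lra. Qed.

(** Axis points turn inclusions of boxes into inequalities between half-widths, and witness that
    boxes and layers are nonempty. *)
Lemma box_scale_basis L c (i : 'I_d) : 0 <= c ->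
  box L (c *: basis_vec i : 'rV[R]_d) <-> c <= L.
Proof.
move=> c0; split=> [/(_ i)|cL j].
  by rewrite mxE basis_vecE eqxx mulr1 => /andP[].
rewrite mxE basis_vecE.
by apply/andP; split; case: (j == i); rewrite /= ?mulr1 ?mulr0; lra.
Qed.

Lemma enorm_scale_basis c (i : 'I_d) :
  enorm (c *: basis_vec i : 'rV[R]_d) = `|c|.
Proof.
rewrite /enorm /dot (bigD1 i)//= big1 => [|j ji].
  by rewrite mxE basis_vecE eqxx mulr1 addr0 -expr2 sqrtr_sqr.
by rewrite mxE basis_vecE (negPf ji) mulr0 mul0r.
Qed.

Lemma dist_sets_le (S T : set 'rV[R]_d) x y : S x -> T y ->
  dist_sets S T <= enorm (x - y).
Proof.
move=> Sx Ty; apply: ge_inf; last by exists x => //; exists y.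
by exists 0 => _ [u Su [v Tv <-]]; exact: sqrtr_ge0.
Qed.

(* The layer is half-open, so the distance is approached along a coordinate
   axis and not attained. *)
Lemma dist_box_layer_le L L' h : (0 < d)%N -> 0 < h -> 0 <= L -> L <= L' - h ->
  dist_sets (box L : set 'rV[R]_d) (box_layer L' h) <= L' - h - L.
Proof.
move=> hd h0 L0 LL'; apply/ler_addgt0Pr => e e0.
pose i := Ordinal hd; pose delta := Num.min e h.
have delta0 : 0 < delta by rewrite lt_min e0 h0.
have [deltae deltah] : delta <= e /\ delta <= h by rewrite !ge_min !lexx orbT.
(* The second point lies in the layer: [delta > 0] pushes it out of the inner box, [delta <= h]
   keeps it in [box L']. Its distance to the first is L' - h - L + delta. *)
apply: (@le_trans _ _ (enorm
    (L *: basis_vec i - (L' - h + delta) *: basis_vec i))).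
  apply: dist_sets_le; first exact/box_scale_basis.
  have y0 : 0 <= L' - h + delta by lra.
  split; first by apply/box_scale_basis; lra.
  by rewrite inner_boxE => /(box_scale_basis _ _ y0); lra.
by rewrite -scalerBl enorm_scale_basis distrC ger0_norm; lra.
Qed.

End Boxes.

(** Induction on [k]: the case 0 is the discrete maximum principle, and each later case applies one
    step of the scheme, whose neighbours lie in the previous box. The global bound [M] only starts
    the contraction argument and leaves no trace in the estimate. *)
Lemma box_decay (R : realType) (d : nat) (lambda N h L rho G M : R)
    (q : 'rV[R]_d -> 'rV[R]_d) (e : 'rV[R]_d -> R) :
  (0 < d)%N -> 0 < lambda -> 0 < N -> 0 < h -> 0 <= rho -> 0 <= G ->
  (forall x i, `|q x 0 i| <= 2 * N) -> (forall x, `|e x| <= M) ->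
  (forall x, inner_box L h x -> `|discrete_op lambda N h (q x) e x| <= rho) ->
  (forall x, box_layer L h x -> `|e x| <= G) ->
  forall (k : nat) x, box (L - k%:R * h) x ->
    `|e x| <= rho / lambda + (1 + lambda * h / (2 * d%:R * N))^-1 ^+ k * G.
Proof.
move=> hd l0 N0 h0 rho0 G0 qN eM eop eG.
set kappa := (1 + _)^-1.
have s0 : 0 < lambda * h / (2 * d%:R * N).
  by rewrite divr_gt0 ?mulr_gt0 ?ltr0n.
have kappa0 : 0 <= kappa by rewrite invr_ge0; lra.
have kappa1 : kappa < 1 by rewrite invf_lt1 ?ltrDl ?addr_gt0.
have a0 : 0 <= rho / lambda by rewrite divr_ge0 ?(ltW l0).
have step x B : box (L - h) x ->
    (forall y, box L y -> `|e y| <= rho / lambda + B) ->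
    `|e x| <= rho / lambda + kappa * B.
  move=> bx eB; apply: (one_step_bound hd l0 N0 h0 (qN x)).
  - by apply: eop; rewrite inner_boxE.
  - by move=> i; apply: eB; exact: (box_neighbour i h0 bx).1.
  - by move=> i; apply: eB; exact: (box_neighbour i h0 bx).2.
elim=> [|k IH] x bx.
  rewrite expr0 mul1r; rewrite mul0r subr0 in bx.
  apply: (contraction_bound kappa1 (fun y _ => eM y) _ bx) => K K0 eK y by_.
  (* In the inner box one step turns the excess G + K into kappa (G + K) <= G + kappa K; on the
     layer [G] bounds directly. *)
  have [iy|iy] := pselect (inner_box L h y).
    have : `|e y| <= rho / lambda + kappa * (G + K).
      apply: step; first by rewrite -inner_boxE.
      by move=> z /eK; rewrite addrA.
    have : kappa * G <= G by exact: ler_piMl (ltW kappa1).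
    rewrite mulrDr; lra.
  have := eG y (conj by_ iy); have : 0 <= kappa * K by rewrite mulr_ge0.
  lra.
rewrite exprS -mulrA.
have bk : box (L - k%:R * h - h) x.
  by move: bx; rewrite -natr1 mulrDl mul1r opprD addrA.
apply: (one_step_bound hd l0 N0 h0 (qN x)).
- apply: eop; rewrite inner_boxE; apply: le_box bk.
  by rewrite lerB// lerBlDr lerDl mulr_ge0 ?ler0n ?(ltW h0).
- by move=> i; apply: IH; exact: (box_neighbour i h0 bk).1.
- by move=> i; apply: IH; exact: (box_neighbour i h0 bk).2.
Qed.

(** * Bounds on the drift and the running cost *)

Section Control.
Context {R : realType} {d m : nat}.
Implicit Types (A : set 'rV[R]_m) (Omega : set 'rV[R]_d).

Lemma entry_le_norm (x : 'rV[R]_d) i : `|x 0 i| <= `|x|.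
Proof.
have -> : `|x| = mx_norm x by [].
by rewrite mx_normrE; apply: (le_bigmax _ (fun k => `|x k.1 k.2|) (0, i)).
Qed.

Lemma drift_le A (b : 'rV[R]_d -> 'rV[R]_m -> 'rV[R]_d) x a i :
  bounded_coef A b -> A a -> `|b x a 0 i| <= max_drift A b.
Proof.
move=> /bounded_on_exists[M bM] Aa.
apply: (@le_trans _ _ (\big[Num.max/0]_(i < d) `|b x a 0 i|)).
  exact: (le_bigmax _ (fun i => `|b x a 0 i|)).
apply: ub_le_sup; last by exists (x, a).
exists M => _ [z Az <-]; apply: bigmax_le => [|j _].
  exact: le_trans (bM z Az).
exact: le_trans (entry_le_norm _ _) (bM z Az).
Qed.

Lemma penalty_ge0 Omega (Mp : R) x : closure Omega !=set0 -> 0 <= Mp ->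
  0 <= penalty Omega Mp x.
Proof.
move=> [y0 Oy0] Mp0; rewrite /penalty le_min Mp0 andbT.
apply: lb_le_inf; first by exists (enorm (x - y0)), y0.
by move=> _ [y _ <-]; exact: sqrtr_ge0.
Qed.

Lemma running_cost_le Omega A (f : 'rV[R]_d -> 'rV[R]_m -> R) (Mp eps : R)
    (pol : 'rV[R]_d -> 'rV[R]_m) x :
  closure Omega !=set0 -> 0 <= Mp -> 0 < eps -> bounded_coef A f -> A (pol x) ->
  `|running_cost Omega f Mp eps pol x| <=
    sup_norm (setT `*` A) (fun z => f z.1 z.2) + Mp / eps.
Proof.
move=> O0 Mp0 eps0 /bounded_on_exists[M fM] Ax.
apply: le_trans (ler_normD _ _) _; apply: lerD.
  exact: (sup_norm_ge fM (conj I Ax : (setT `*` A) (x, pol x))).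
rewrite ger0_norm; last by rewrite divr_ge0 ?penalty_ge0 ?(ltW eps0).
by rewrite ler_pM2r ?invr_gt0// ge_min lexx orbT.
Qed.

End Control.

(** * The error estimate on the smaller box *)

Theorem corollary6p2 (R : realType) (d m : nat) (hd : (0 < d)%N)
  (Omega : set 'rV[R]_d) (n : 'rV[R]_d -> 'rV[R]_d) (A : set 'rV[R]_m)
  (b : 'rV[R]_d -> 'rV[R]_m -> 'rV[R]_d) (f : 'rV[R]_d -> 'rV[R]_m -> R)
  (lambda nu Mp N h eps : R)
  (Omega_domain : is_domain Omega)
  (Omega_bounded : bounded_set Omega)
  (Omega_C2 : C2_boundary Omega)
  (n_normal : forall x, boundary Omega x -> outward_unit_normal Omega x (n x))
  (A_compact : compact A)
  (lambda_gt0 : 0 < lambda)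
  (b_cont : continuous_coef A b)
  (b_bounded : bounded_coef A b)
  (b_lip : lipschitz_coef enorm A b)
  (b_Lip_lt : Lipx enorm A b < lambda)
  (f_ge0 : forall x a, A a -> 0 <= f x a)
  (f_cont : continuous_coef A f)
  (f_bounded : bounded_coef A f)
  (f_lip : lipschitz_coef Num.norm A f)
  (nu_gt0 : 0 < nu)
  (inward : forall x, boundary Omega x ->
    exists2 a, A a & dot (b x a) (n x) <= - nu)
  (H_coercive : uniformly_coercive Omega (hamiltonian A b f))
  (Mp_gt0 : 0 < Mp)
  (N_gt0 : 0 < N)
  (N_ge : 2^-1 * max_drift A b <= N)
  (h_gt0 : 0 < h)
  (eps_gt0 : 0 < eps)
  (L L' : R)
  (h_lt_L : h < L)
  (h_lt_L' : h < L')
  (Omega_in_L : closure Omega `<=` (box L)°)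
  (Omega_in_L' : closure Omega `<=` (box L')°)
  (L_in_L' : box L `<=` (inner_box L' h : set 'rV[R]_d)°)
  (h_small : lambda * h <= 2 * d%:R * N)
  (pi_n : 'rV[R]_d -> 'rV[R]_m)
  (pi_n_policy : is_policy A pi_n)
  (w_n : 'rV[R]_d -> R)
  (w_n_value : is_policy_value Omega b f lambda Mp N eps h pi_n w_n)
  (v_n : 'rV[R]_d -> R)
  (v_n_bb : bounded_borel v_n) :
  let xi_val := sup_norm (box L) (fun x => v_n x - w_n x) in
  let d_LL' := dist_sets (box L : set 'rV[R]_d) (box_layer L' h) in
  let M_eps := (sup_norm (setT `*` A) (fun z => f z.1 z.2) + Mp / eps)
               / lambda in
  xi_val <=
    lambda^-1 *
      sup_norm (inner_box L' h) (policy_op Omega b f lambda Mp N eps h pi_n v_n)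
    + expR (- (lambda * d_LL' / (4 * d%:R * N)))
      * (sup_norm (box_layer L' h) v_n + M_eps).
Proof.
lazy zeta; set d_LL' := dist_sets _ _; set M_eps := (_ / lambda).
have [_ polA] := pi_n_policy.
have [[_ w_bounded] w_eq] := w_n_value.
have [_ v_bounded] := v_n_bb.
have [Mw wM'] := bounded_on_exists w_bounded; have wM x := wM' x I.
have [Mv vM'] := bounded_on_exists v_bounded; have vM x := vM' x I.
have O0 : closure Omega !=set0.
  by have [_ _ [x Ox]] := Omega_domain; exists x; exact: subset_closure.
pose q x := b x (pi_n x).
have qN x i : `|q x 0 i| <= 2 * N.
  have := drift_le x i b_bounded (polA x); rewrite -/(q x); lra.
pose cost := running_cost Omega f Mp eps pi_n.
pose C := sup_norm (setT `*` A) (fun z => f z.1 z.2) + Mp / eps.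
have costC x : `|cost x| <= C by exact: running_cost_le (ltW Mp_gt0) _ _ _.
have C0 : 0 <= C by exact: le_trans (costC 0).
have M_eps0 : 0 <= M_eps by rewrite divr_ge0 ?(ltW lambda_gt0).
(* [policy_op] unfolds to [discrete_op] minus the running cost. *)
have w_op x : discrete_op lambda N h (q x) w_n x = cost x.
  by apply/eqP; rewrite -subr_eq0; apply/eqP; exact: w_eq.
have s0 : 0 < lambda * h / (2 * d%:R * N).
  by rewrite divr_gt0 ?mulr_gt0 ?ltr0n.
(* The whole space has no layer, so contraction leaves only C / lambda, which is [M_eps]. *)
have w_le x : `|w_n x| <= M_eps.
  have kappa1 : (1 + lambda * h / (2 * d%:R * N))^-1 < 1.
    by rewrite invf_lt1 ?ltrDl ?addr_gt0.
  apply: (contraction_bound kappa1 (fun y (_ : setT y) => wM y)) => // K K0 wK y _.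
  by apply: one_step_bound (qN y) _ _ _ => // [|i|i]; rewrite ?w_op//; exact: wK.
set P := policy_op _ _ _ _ _ _ _ _ _ v_n.
(* Finiteness of the residual, so that [rho] below really bounds it. *)
have P_le x : `|P x| <= (lambda + 4 * d%:R * N / h) * Mv + C.
  apply: le_trans (ler_normB _ _) (lerD _ (costC x)).
  exact: discrete_op_le (qN x) vM.
have i : 'I_d := Ordinal hd.
set rho := sup_norm (inner_box L' h) P.
have P_rho x : inner_box L' h x -> `|P x| <= rho.
  exact: sup_norm_ge (fun y _ => P_le y).
have rho0 : 0 <= rho.
  apply: le_trans (P_rho 0 _) => // j; rewrite mxE; apply/andP; split; lra.
set Gv := sup_norm (box_layer L' h) v_n.
have v_Gv x : box_layer L' h x -> `|v_n x| <= Gv.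
  exact: sup_norm_ge (fun y _ => vM y).
have L_pos : 0 <= L by lra.
have L'_pos : 0 <= L' by lra.
have layerL' : box_layer L' h (L' *: basis_vec i).
  split; first exact/box_scale_basis.
  by rewrite inner_boxE => /(box_scale_basis _ _ L'_pos); lra.
have Gv0 : 0 <= Gv by exact: le_trans (v_Gv _ layerL').
(* The inclusion of boxes is tested at the axis point of [box L] with coordinate [L]. *)
have LL' : L <= L' - h.
  apply/(box_scale_basis (L' - h) i L_pos); rewrite -inner_boxE.
  by apply: interior_subset; apply: L_in_L'; exact/box_scale_basis.
(* The largest number of retreats by [h] from [L'] that still contain [box L]. Rounding loses less
   than one [h], and the distance to the layer is at most L' - h - L, so k h still dominates
   [d_LL']. *)
pose k := Num.trunc ((L' - L) / h).
have /andP[k_le k_gt] : k%:R <= (L' - L) / h < k.+1%:R.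
  by apply: truncn_itv; rewrite divr_ge0 ?(ltW h_gt0)//; lra.
rewrite ler_pdivlMr// in k_le; rewrite ltr_pdivrMr// -natr1 mulrDl mul1r in k_gt.
have kd : d_LL' <= k%:R * h.
  by apply: le_trans (dist_box_layer_le hd h_gt0 L_pos LL') _; lra.
have decay x : box L x -> `|v_n x - w_n x| <=
    rho / lambda + (1 + lambda * h / (2 * d%:R * N))^-1 ^+ k * (Gv + M_eps).
  move=> bx; apply: (@box_decay _ _ lambda N h L' rho (Gv + M_eps) (Mv + M_eps) q
    (fun y => v_n y - w_n y)) => //.
  - exact: addr_ge0.
  - by move=> y; apply: le_trans (ler_normB _ _) (lerD _ _).
  (* Both functions see the same cost, so the operator applied to the difference is exactly the
     residual [P] of [v_n]. *)
  - by move=> y iy; rewrite discrete_opB w_op; exact: P_rho.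
  - by move=> y ly; apply: le_trans (ler_normB _ _) (lerD (v_Gv y ly) _).
  - by apply: le_box bx; lra.
apply: sup_norm_le => [|x bx].
  by exists (L *: basis_vec i); exact/box_scale_basis.
apply: le_trans (decay x bx) _; rewrite [lambda^-1 * _]mulrC lerD2l.
apply: ler_wpM2r; first exact: addr_ge0.
(* Here s = lambda h/(2dN), and [h_small] says that s <= 1. *)
apply: le_trans (inv1D_exp_le k _) _.
  rewrite ltW//= ler_pdivrMr ?mul1r// ?mulr_gt0 ?ltr0n//.
rewrite ler_expR lerN2.
(* The exponent s/2 per retreat doubles 2dN to 4dN; [kd] then replaces k h by the distance. *)
have -> : k%:R * (lambda * h / (2 * d%:R * N) / 2) =
    lambda * (k%:R * h) / (4 * d%:R * N).
  by field; rewrite !gt_eqF ?ltr0n.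
by rewrite ler_pM2r ?ler_pM2l// invr_gt0 !mulr_gt0 ?ltr0n.
Qed.
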